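(* Let $p$ be the mesh pattern $(12,R)$ with $R=\{(0,0),(0,1),(1,2),(2,0),(2,1)\}$, let $E(t,u)=\sum_{n\ge0}t^n\sum_{\sigma\in K_n}u^{p(\sigma)}$, and let $P(t)=\sum_{n\ge0}|K_n(p)|t^n$. Then $$P(t)=\frac{2A(t)-t-1}{A(t)-t},\qquad E(t,u)=\frac{(1+t)(1-u)+(-2+u+ut^2)A(t)}{-u+t(1-u+ut)-(1-u)A(t)}.$$ The initial terms of $E(t,u)$ are $1+t+2t^4+(12+2u)t^5+(76+14u)t^6+(556+88u+2u^2)t^7+(4592+636u+14u^2)t^8+\cdots$.
   Context: A permutation $\sigma=\sigma_1\cdots\sigma_n$ of $\{1,\dots,n\}$ is a king permutation if $|\sigma_{i+1}-\sigma_i|>1$ for all $1\le i\le n-1$. $K_n$ is the set of king permutations of length $n$ ($K_0$ = the empty permutation, $K_1=\{1\}$) and $A(t)=\sum_{n\ge0}|K_n|t^n$ (known to equal $\sum_{n\ge0}n!\,t^n(1-t)^n/(1+t)^n$). For a mesh pattern $p=(12,R)$ with $R\subseteq\{0,1,2\}^2$, an occurrence of $p$ in $\sigma\in S_n$ is a pair of positions $i_1<i_2$ with $\sigma_{i_1}<\sigma_{i_2}$ such that for every $(x,y)\in R$ there is no position $m$ with $i_x<m<i_{x+1}$ and $v_y<\sigma_m<v_{y+1}$, where $i_0=0$, $i_3=n+1$, $v_0=0$, $v_1=\sigma_{i_1}$, $v_2=\sigma_{i_2}$, $v_3=n+1$ (first coordinate of a box indexes positions, second values). $p(\sigma)$ is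 the number of occurrences of $p$ in $\sigma$; $K_n(p)$ is the set of king $n$-permutations with $p(\sigma)=0$. *)

(* Defs.v *)
From HB Require Import structures.
From mathcomp Require Import all_boot all_order all_algebra all_fingroup.
From mathcomp Require Import boolp.

Set Implicit Arguments.
Unset Strict Implicit.
Unset Printing Implicit Defensive.

Import GRing.Theory.

Local Open Scope ring_scope.

(* The commutative ring R[[t]] of formal power series; as R[[t]] has no
   decidable equality, its eqType and choiceType structures are classical.     *)

Record fps (R : Type) := Fps { fps_coef :> nat -> R }.

HB.instance Definition _ (R : Type) := gen_eqMixin (fps R).
HB.instance Definition _ (R : Type) := gen_choiceMixin (fps R).

Lemma fpsP (R : Type) (f g : fps R) : f =1 g -> f = g.
Proof. by case: f g => [f] [g] /= /funext ->. Qed.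

Section FpsZmod.
Variable R : zmodType.
Implicit Types f g h : fps R.

Definition fps_zero : fps R := Fps (fun=> 0).
Definition fps_add f g : fps R := Fps (fun n => f n + g n).
Definition fps_opp f : fps R := Fps (fun n => - f n).

Fact fps_addA : associative fps_add.
Proof. by move=> f g h; apply: fpsP => n /=; rewrite addrA. Qed.
Fact fps_addC : commutative fps_add.
Proof. by move=> f g; apply: fpsP => n /=; rewrite addrC. Qed.
Fact fps_add0 : left_id fps_zero fps_add.
Proof. by move=> f; apply: fpsP => n /=; rewrite add0r. Qed.
Fact fps_addN : left_inverse fps_zero fps_opp fps_add.
Proof. by move=> f; apply: fpsP => n /=; rewrite addNr. Qed.

HB.instance Definition _ :=
  GRing.isZmodule.Build (fps R) fps_addA fps_addC fps_add0 fps_addN.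

Lemma fps0E n : (0 : fps R) n = 0. Proof. by []. Qed.
Lemma fpsDE f g n : (f + g) n = f n + g n. Proof. by []. Qed.
Lemma fpsNE f n : (- f) n = - f n. Proof. by []. Qed.
End FpsZmod.

Section FpsRing.
Variable R : comNzRingType.
Implicit Types (f g h : fps R) (c : R).

(* The constant series c and the variable t. *)
Definition fpsC c : fps R := Fps (fun n => if n == 0%N then c else 0).
Definition fpsX : fps R := Fps (fun n => if n == 1%N then 1 else 0).

Definition fps_mul f g : fps R :=
  Fps (fun n => \sum_(i < n.+1) f i * g (n - i)%N).

Let trunc n f : {poly R} := \poly_(i < n.+1) f i.

Let coef_trunc n f k : (k <= n)%N -> (trunc n f)`_k = f k.
Proof. by move=> lekn; rewrite coef_poly ltnS lekn. Qed.

Let mul_trunc n f g k : (k <= n)%N ->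
  fps_mul f g k = (trunc n f * trunc n g)`_k.
Proof.
move=> lekn; rewrite coefM; apply: eq_bigr => i _.
rewrite !coef_trunc //; first exact: leq_trans (leq_subr _ _) lekn.
by apply: leq_trans lekn; rewrite -ltnS.
Qed.

Fact fps_mulC : commutative fps_mul.
Proof. by move=> f g; apply: fpsP => n; rewrite !(@mul_trunc n) // mulrC. Qed.

Fact fps_mulA : associative fps_mul.
Proof.
move=> f g h; apply: fpsP => n.
transitivity (trunc n f * (trunc n g * trunc n h))`_n.
  rewrite coefM; apply: eq_bigr => i _.
  by rewrite coef_trunc -1?ltnS // -mul_trunc // leq_subr.
rewrite mulrA coefM; apply: eq_bigr => i _.
by rewrite coef_trunc ?leq_subr // -mul_trunc // -ltnS.
Qed.

Fact fps_mul1 : left_id (fpsC 1) fps_mul.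
Proof.
move=> f; apply: fpsP => n /=.
by rewrite big_ord_recl big1 ?addr0 ?mul1r ?subn0 // => i _; rewrite mul0r.
Qed.

Fact fps_mulDl : left_distributive fps_mul +%R.
Proof.
move=> f g h; apply: fpsP => n /=.
by rewrite -big_split; apply: eq_bigr => i _; rewrite mulrDl.
Qed.

Fact fps_oner_neq0 : fpsC 1 != 0.
Proof.
by apply/eqP => /(congr1 (fun f : fps R => f 0%N)) /eqP; rewrite /= oner_eq0.
Qed.

HB.instance Definition _ := GRing.Zmodule_isComNzRing.Build (fps R)
  fps_mulA fps_mulC fps_mul1 fps_mulDl fps_oner_neq0.

Lemma fps1E n : (1 : fps R) n = if n == 0%N then 1 else 0. Proof. by []. Qed.
Lemma fpsME f g n : (f * g) n = \sum_(i < n.+1) f i * g (n - i)%N.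
Proof. by []. Qed.
End FpsRing.

Arguments fpsX {R}.

Section FpsUnitRing.
Variable R : comUnitRingType.
Implicit Types f g : fps R.

Definition fps_unit : {pred fps R} := fun f => f 0%N \is a GRing.unit.

(* The first n coefficients of 1 / f. *)
Fixpoint fps_inv_seq f (n : nat) : seq R :=
  if n isn't m.+1 then [::] else
  let s := fps_inv_seq f m in
  rcons s ((f 0%N)^-1 * ((m == 0%N)%:R - \sum_(i < m) s`_i * f (m - i)%N)).

(* As required by unitRingType, non-invertible series are left unchanged. *)
Definition fps_inv f : fps R :=
  if fps_unit f then Fps (fun n => (fps_inv_seq f n.+1)`_n) else f.

Let size_inv_seq f n : size (fps_inv_seq f n) = n.
Proof. by elim: n => //= n IHn; rewrite size_rcons IHn. Qed.

Let nth_inv_seq f n k : (k < n)%N ->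
  (fps_inv_seq f n)`_k = (fps_inv_seq f k.+1)`_k.
Proof.
elim: n => // n IHn; rewrite ltnS leq_eqVlt => /predU1P[-> // | ltkn].
by rewrite [LHS]/= nth_rcons size_inv_seq ltkn IHn.
Qed.

Fact fps_mulVx : {in fps_unit, left_inverse 1 fps_inv *%R}.
Proof.
move=> f Uf; apply: fpsP => n; rewrite fpsME /fps_inv [fps_unit f]Uf big_ord_recr /= subnn.
rewrite nth_rcons size_inv_seq ltnn eqxx mulrAC mulVr // mul1r addrC.
rewrite [X in _ + X](eq_bigr
  (fun i : 'I_n => (fps_inv_seq f n)`_i * f (n - i)%N)).
  by rewrite subrK; case: eqP.
by move=> i _; rewrite [in RHS]nth_inv_seq.
Qed.

Fact fps_unitPl f g : g * f = 1 -> fps_unit f.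
Proof.
move=> /(congr1 (fun h : fps R => h 0%N)); rewrite fpsME big_ord1 => gf1.
by apply/unitrPr; exists (g 0%N); rewrite mulrC.
Qed.

Fact fps_invr_out : {in [predC fps_unit], fps_inv =1 id}.
Proof. by move=> f; rewrite !inE => /negPf Uf; rewrite /fps_inv [fps_unit f]Uf. Qed.

HB.instance Definition _ := GRing.ComNzRing_hasMulInverse.Build (fps R)
  fps_mulVx fps_unitPl fps_invr_out.

Lemma fps_unitE f : (f \is a GRing.unit) = (f 0%N \is a GRing.unit).
Proof. by []. Qed.
End FpsUnitRing.

(* Positions and values are 0-based in 'S_n, hence the shifts by one below
   wherever they are compared with the bounds 0 and n + 1.                    *)

Definition king (n : nat) (s : 'S_n) : bool :=
  [forall i : 'I_n, forall j : 'I_n,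
     (j == i.+1 :> nat) ==> (1 < `|(s j)%:Z - (s i)%:Z|)].

Definition king_perms (n : nat) : {set 'S_n} := [set s | king s].

(* (x, y) \in R stands for the box in column x (positions) and row y (values). *)
Definition mesh := {set 'I_3 * 'I_3}.

Definition is_occ12 (R : mesh) (n : nat) (s : 'S_n) (i1 i2 : 'I_n) : bool :=
  let pos := nth 0%N [:: 0; i1.+1; i2.+1; n.+1]%N in
  let val := nth 0%N [:: 0; (s i1).+1; (s i2).+1; n.+1]%N in
  [&& (i1 < i2)%N, (s i1 < s i2)%N &
   [forall b in R, ~~ [exists m : 'I_n,
      (pos b.1 < m.+1 < pos b.1.+1)%N && (val b.2 < (s m).+1 < val b.2.+1)%N]]].

Definition occ12 (R : mesh) (n : nat) (s : 'S_n) : nat :=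
  #|[set ij : 'I_n * 'I_n | is_occ12 R s ij.1 ij.2]|.

Definition king_avoiders (R : mesh) (n : nat) : {set 'S_n} :=
  [set s in king_perms n | occ12 R s == 0%N].

Definition king_gf (K : comNzRingType) : fps K :=
  Fps (fun n => #|king_perms n|%:R).

Lemma king_gf0 (K : comNzRingType) : king_gf K 0%N = 1.
Proof.
rewrite /= (_ : king_perms 0 = [set: 'S_0]) ?cardsT ?card_Sn //.
by apply/setP => s; rewrite !inE; apply/forallP => -[].
Qed.

Definition avoid_gf (R : mesh) : fps int :=
  Fps (fun n => #|king_avoiders R n|%:R).

(* The variable u is the indeterminate of {poly int}. *)
Definition distr_gf (R : mesh) : fps {poly int} :=
  Fps (fun n => \sum_(s in king_perms n) 'X ^+ occ12 R s).

Definition mesh_p : mesh :=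
  [set b | (val b.1, val b.2)
             \in [:: (0, 0); (0, 1); (1, 2); (2, 0); (2, 1)]%N].

(* Main.v *)
Require Import Defs.
From mathcomp Require Import all_boot all_order all_algebra all_fingroup.
From mathcomp Require Import zify ring.

(**
  An occurrence of p in s is a set of consecutive positions, at least two, that
  carries exactly the values 1, ..., b and ends with b; it is determined by b.
  Contracting the block of the first occurrence of a king permutation leaves a
  permutation whose only possible defect is an adjacent factor "21". Writing
  P, E for the two series of the theorem, F (resp. G) for the analogue of E in
  which the factor 21 (resp. 12) is also allowed, contraction of blocks gives
    E = P + u (P - 1 - t) (F - 1),  F = E + t (G - 1),  G = E + u t (F - 1),
  because the first block, without its last letter, is an arbitrary king
  permutation of length at least 2 avoiding p. At u = 1, where E = A, these
  equations determine P, and then E for every u.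
*)

Set Implicit Arguments.
Unset Strict Implicit.
Unset Printing Implicit Defensive.

Import GRing.Theory.

(** * Words, the king condition and occurrences *)

Definition kingr (a b : nat) : bool := (a.+1 < b) || (b.+1 < a).

(** Letters being 0-based, the factors 21 and 12 read 10 and 01: [kingx 1 0] gives the words counted
    by F, [kingx 0 1] those counted by G. *)
Definition kingx (c d a b : nat) : bool := kingr a b || (a == c) && (b == d).

Definition words (n : nat) : seq (seq nat) := permutations (iota 0 n).

(* The letters [0 .. b] of [l] are consecutive and [b] comes last among them;
   words are 0-based, so the occurrences of p are counted by [0 < b]. *)
Definition wocc (l : seq nat) (b : nat) : bool :=
  let f := filter (leq^~ b) l in (last 0 f == b) && infix f l.

Definition wocc12 (l : seq nat) : nat := count (wocc l) (iota 1 (size l).-1).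

Lemma mem_words n l : (l \in words n) = perm_eq l (iota 0 n).
Proof. exact: mem_permutations. Qed.

Lemma size_words n l : l \in words n -> size l = n.
Proof. by rewrite mem_words => /perm_size; rewrite size_iota. Qed.

Lemma uniq_words n l : l \in words n -> uniq l.
Proof. by rewrite mem_words => /perm_uniq ->; exact: iota_uniq. Qed.

Lemma mem_in_words n l v : l \in words n -> (v \in l) = (v < n).
Proof. by rewrite mem_words => /perm_mem ->; rewrite mem_iota. Qed.

Lemma filter_leq_gt b s : all (ltn b) s -> filter (leq^~ b) s = [::].
Proof.
move=> s_gt; apply/eqP; rewrite -size_eq0 size_filter eqn0Ngt -has_count -all_predC.
by apply: sub_all s_gt => c /=; lia.
Qed.

Lemma woccP l b : 0 < b ->
  reflect (exists x y z, [/\ l = x ++ rcons y b ++ z, all (leq^~ b) y,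
                             all (ltn b) x & all (ltn b) z])
          (wocc l b).
Proof.
move=> b_gt0; apply: (iffP andP) => [[/eqP lastb /infixP[x [z def_l]]]|].
  set f := filter _ l in lastb def_l.
  (* The filter fixes [f], so comparing lengths after filtering both sides of [def_l] leaves no
     letter at most [b] in [x] or [z]. *)
  have fK : filter (leq^~ b) f = f by rewrite /f filter_id.
  have := congr1 (size \o filter (leq^~ b)) def_l.
  rewrite /= -/f !filter_cat fK !size_cat => sz.
  have nil0 s : size (filter (leq^~ b) s) = 0 -> all (ltn b) s.
    move/eqP; rewrite size_filter eqn0Ngt -has_count -all_predC.
    by apply: sub_all => c /=; lia.
  have [x0 z0] : size (filter (leq^~ b) x) = 0 /\ size (filter (leq^~ b) z) = 0 by lia.
  case/lastP def_f: {+}f lastb => [|y c]; first by move=> /= b0; rewrite -b0 in b_gt0.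
  rewrite last_rcons => def_c; rewrite def_c in def_f.
  exists x, y, z; split; [by rewrite -def_f | | exact: nil0 | exact: nil0].
  have := filter_all (leq^~ b) l; rewrite -/f def_f all_rcons.
  by case/andP.
move=> [x [y [z [-> y_le x_gt z_gt]]]].
rewrite !filter_cat (filter_leq_gt x_gt) (filter_leq_gt z_gt) cats0 /=.
rewrite filter_rcons leqnn (all_filterP y_le) last_rcons.
by split=> //; apply/infixP; exists x, z.
Qed.

(** * Inflation of the letter 0 and its inverse *)

(** A block carries the smallest values, so contracting it always yields the letter 0; the other
    letters are shifted by the length of the block, less one. *)
Definition infl (pi tau : seq nat) : seq nat :=
  flatten [seq if v is w.+1 then [:: w + size pi] else pi | v <- tau].

(* [h] is the letter of the inflating word that is kept, as a representative
   of the contracted block. *)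
Definition deflv (k h v : nat) : option nat :=
  if v < k then (if v == h then Some 0 else None) else Some (v - k).+1.

Definition defl k h : seq nat -> seq nat := pmap (deflv k h).

Lemma infl_cat pi s1 s2 : infl pi (s1 ++ s2) = infl pi s1 ++ infl pi s2.
Proof. by rewrite /infl map_cat flatten_cat. Qed.

Lemma infl_cons0 pi s : infl pi (0 :: s) = pi ++ infl pi s.
Proof. by []. Qed.

Lemma infl_consS pi v s : infl pi (v.+1 :: s) = v + size pi :: infl pi s.
Proof. by []. Qed.

Lemma infl_pos pi s : all (ltn 0) s ->
  infl pi s = [seq v.-1 + size pi | v <- s].
Proof. by rewrite /infl; elim: s => // -[//|v] s IHs /= /IHs ->. Qed.

Lemma defl_cat k h s1 s2 : defl k h (s1 ++ s2) = defl k h s1 ++ defl k h s2.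
Proof. exact: pmap_cat. Qed.

Lemma words0_in n l : l \in words n -> 0 < n ->
  exists x z, [/\ l = x ++ 0 :: z, all (ltn 0) x & all (ltn 0) z].
Proof.
move=> ln n_gt0; have := uniq_words ln.
have /splitPr[x z] : 0 \in l by rewrite (mem_in_words _ ln).
rewrite cat_uniq /= negb_or => /and4P[_ /andP[x0 _] z0 _].
have pos s : 0 \notin s -> all (ltn 0) s.
  by move=> s0; apply/allP => -[/(negP s0)|].
by exists x, z; split=> //; apply: pos.
Qed.

Lemma iota_pos m n : 0 < m -> all (ltn 0) (iota m n).
Proof. by move=> m0; apply/allP=> v; rewrite mem_iota /=; lia. Qed.

Lemma infl_iota pi m : infl pi (iota 0 m.+1) = pi ++ iota (size pi) m.
Proof.
rewrite -[iota 0 m.+1]/(0 :: iota 1 m) infl_cons0 infl_pos ?iota_pos //.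
congr (_ ++ _); rewrite (iotaDl 1 0) -map_comp -[in RHS](addn0 (size pi)) iotaDl.
by apply: eq_map => v /=; rewrite addnC.
Qed.

Lemma infl_words k m pi tau : pi \in words k -> tau \in words m.+1 ->
  infl pi tau \in words (m + k).
Proof.
move=> pik; rewrite !mem_words => /(perm_map (fun v => if v is w.+1 then [:: w + size pi] else pi)).
move/perm_flatten/perm_trans; apply; rewrite -/(infl _ _) infl_iota (size_words pik).
rewrite addnC iotaD perm_cat2r -?mem_words //.
Qed.

Lemma defl_low k h s : all (gtn k) s -> uniq s -> h \in s -> defl k h s = [:: 0].
Proof.
move=> sk us hs; rewrite /defl.
have -> : pmap (deflv k h) s = [seq 0 | v <- s & v == h].
  elim: s sk {us hs} => //= v s IHs /andP[vk /IHs ->].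
  by rewrite /deflv vk; case: eqP.
rewrite -/(pred1 h) (_ : [seq v <- s | v == h] = [:: h]) //.
apply: perm_small_eq => //; apply: uniq_perm => //; first exact: filter_uniq.
by move=> v; rewrite mem_filter inE; case: eqP => // ->.
Qed.

(** Of each inserted copy of [pi] only the letter [h] survives, as 0; any choice of [h] below [k]
    works. *)
Lemma inflK k pi h tau : pi \in words k -> h < k -> defl k h (infl pi tau) = tau.
Proof.
move=> pik hk; elim: tau => // -[|v] tau IHtau.
  rewrite infl_cons0 defl_cat IHtau defl_low ?(uniq_words pik) ?(mem_in_words _ pik) //.
  by apply/allP => v; rewrite (mem_in_words _ pik).
rewrite infl_consS /= /deflv (size_words pik) ltnNge leq_addl /= addnK.
by rewrite -/(defl k h) IHtau.
Qed.

(** Together with [inflK] this makes inflation injective in the pair of [pi] and [tau], for blocks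
    of fixed length. *)
Lemma filter_infl k m pi tau : pi \in words k -> tau \in words m.+1 ->
  filter (gtn k) (infl pi tau) = pi.
Proof.
move=> pik taum; have [//|x [z [-> x0 z0]]] := words0_in taum.
have filt0 s : all (ltn 0) s -> filter (gtn k) (infl pi s) = [::].
  move=> s0; rewrite infl_pos // (size_words pik).
  by elim: s s0 => //= v s IHs /andP[v0 /IHs ->]; case: ltnP => //; lia.
rewrite infl_cat infl_cons0 !filter_cat (filt0 x) ?(filt0 z) // cats0 /=.
apply/all_filterP/allP => v; by rewrite (mem_in_words _ pik).
Qed.

Lemma deflK k h pi x z : pi \in words k -> h < k ->
  uniq (x ++ pi ++ z) -> infl pi (defl k h (x ++ pi ++ z)) = x ++ pi ++ z.
Proof.
move=> pik hk u.
have big s : (forall v, v \in s -> k <= v) -> infl pi (defl k h s) = s.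
  elim: s => //= v s IHs sk; have kv := sk v (mem_head _ _).
  rewrite /deflv ltnNge kv /= infl_consS (size_words pik) subnK //.
  by congr (_ :: _); apply: IHs => w ws; apply: sk; rewrite inE ws orbT.
(* All letters below [k] are used up by [pi], so by uniqueness [x] and [z] lose no letter. *)
rewrite !defl_cat !infl_cat (big x) ?(big z); first last.
- move=> v vx; rewrite leqNgt -(mem_in_words _ pik); apply/negP => vpi.
  move: u; rewrite cat_uniq => /and3P[_ /negP[]]; apply/hasP.
  by exists v; rewrite ?mem_cat ?vpi.
- move=> v vx; rewrite leqNgt -(mem_in_words _ pik); apply/negP => vpi.
  move: u; rewrite !cat_uniq => /and5P[_ _ _ /negP[]]; apply/hasP.
  by exists v.
rewrite (defl_low _ (uniq_words pik)) ?(mem_in_words _ pik) //.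
  by rewrite infl_cons0 cats0.
by apply/allP => v; rewrite (mem_in_words _ pik).
Qed.

(** Contraction sends words to words because it respects rearrangement and turns [iota 0 n] into a
    rearrangement of [iota 0 (n - k).+1]. *)
Lemma infl_surj n k pi x z : 0 < k -> pi \in words k -> x ++ pi ++ z \in words n ->
  k <= n /\ exists2 tau, tau \in words (n - k).+1 & x ++ pi ++ z = infl pi tau.
Proof.
move=> k0 pik ln.
have le_kn : k <= n.
  by rewrite -(size_words ln) !size_cat (size_words pik); lia.
split=> //; exists (defl k 0 (x ++ pi ++ z)); last by rewrite deflK ?(uniq_words ln).
move: ln; rewrite !mem_words => /(perm_pmap (deflv k 0))/perm_trans; apply.
rewrite -/(defl k 0) -(subnKC le_kn) iotaD defl_cat defl_low ?iota_uniq ?mem_iota //; last first.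
  by apply/allP => v; rewrite mem_iota.
rewrite add0n addKn -[iota 0 _.+1]/([:: 0] ++ iota 1 _) perm_cat2l.
rewrite -[in iota k _](addn0 k) iotaDl -[in iota 1 _](addn0 1) iotaDl addn0 /defl.
elim: (iota 0 _) => //= v s IHs; rewrite /deflv ltnNge leq_addr /= addKn.
by rewrite perm_cons.
Qed.

(** Such an occurrence concerns only letters below [k], which form the factor [pi]; the letters
    around that factor all exceed [b]. *)
Lemma wocc_infl_low k m pi tau b : pi \in words k -> tau \in words m.+1 ->
  0 < b < k -> wocc (infl pi tau) b = wocc pi b.
Proof.
move=> pik taum /andP[b0 bk]; apply/(woccP _ b0)/(woccP _ b0).
  move=> [x [y [z [def_s yb xb zb]]]]; have := filter_infl pik taum.
  rewrite def_s !filter_cat filter_rcons /= bk => <-.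
  exists (filter (gtn k) x), (filter (gtn k) y), (filter (gtn k) z).
  have sub P s : all P s -> all P (filter (gtn k) s).
    by move/allP=> sP; apply/allP => v; rewrite mem_filter => /andP[_]; apply: sP.
  by split=> //; apply: sub.
move=> [x [y [z [def_pi yb xb zb]]]].
have [//|x1 [z1 [def_tau x10 z10]]] := words0_in taum.
exists (infl pi x1 ++ x), y, (z ++ infl pi z1).
rewrite def_tau infl_cat infl_cons0 {2}def_pi !catA; split=> //.
  rewrite all_cat xb andbT infl_pos // all_map; apply/allP => v _ /=.
  by rewrite (size_words pik); lia.
rewrite all_cat zb infl_pos // all_map; apply/allP => v _ /=.
by rewrite (size_words pik); lia.
Qed.

(** An occurrence ending at a letter outside the block uses every value of the block, hence contains
    it whole; [b.-1 + k] is the letter that [b] becomes. *)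
Lemma wocc_infl_high k m pi tau b : 0 < k -> pi \in words k -> tau \in words m.+1 ->
  0 < b -> wocc (infl pi tau) (b.-1 + k) = wocc tau b.
Proof.
move=> k0 pik taum b0; apply/woccP/woccP=> //; first by lia.
  move=> [x [y [z [def_s yb xb zb]]]].
  have := inflK tau pik k0; rewrite def_s !defl_cat => <-.
  have -> : defl k 0 (rcons y (b.-1 + k)) = rcons (defl k 0 y) b.
    rewrite -!cats1 defl_cat /defl /= /deflv ltnNge leq_addl /= addnK.
    by rewrite prednK.
  have mdefl s v : v \in defl k 0 s -> exists2 w, w \in s & deflv k 0 w = Some v.
    by rewrite mem_pmap => /mapP[w ws ->]; exists w.
  exists (defl k 0 x), (defl k 0 y), (defl k 0 z); split=> //;
    apply/allP => v /mdefl[w ws]; rewrite /deflv.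
  - by have := allP yb w ws; case: ltnP; [case: eqP => // _ _ _ [<-] | move=> ? /= ? [<-]; lia].
  - by have := allP xb w ws; case: ltnP; [case: eqP => // _ /= | move=> ? /= ? [<-]]; lia.
  - by have := allP zb w ws; case: ltnP; [case: eqP => // _ /= | move=> ? /= ? [<-]]; lia.
move=> [x [y [z [def_tau yb xb zb]]]].
exists (infl pi x), (infl pi y), (infl pi z).
have pos s : all (ltn b) s -> all (ltn 0) s by apply: sub_all => v /=; lia.
split.
- rewrite def_tau !infl_cat -!cats1 infl_cat; congr (_ ++ ((_ ++ _) ++ _)).
  by rewrite /infl; case: (b) b0 => //= b' _; rewrite (size_words pik).
- elim: y yb {def_tau} => // v y IHy /= /andP[vb /IHy yb].
  case: v vb => [_|v vb] /=; last by rewrite yb (size_words pik) andbT; lia.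
  rewrite infl_cons0 all_cat yb andbT; apply/allP => v.
  by rewrite (mem_in_words _ pik) /=; lia.
- rewrite infl_pos ?pos // all_map (size_words pik).
  by apply: sub_all xb => v /=; lia.
- rewrite infl_pos ?pos // all_map (size_words pik).
  by apply: sub_all zb => v /=; lia.
Qed.

Lemma wocc12_infl k m pi tau : 0 < k -> pi \in words k -> tau \in words m.+1 ->
  wocc12 (infl pi tau) = wocc12 pi + wocc12 tau.
Proof.
move=> k0 pik taum; rewrite /wocc12 (size_words (infl_words pik taum)).
rewrite (size_words pik) (size_words taum) /=.
have -> : (m + k).-1 = k.-1 + m by lia.
rewrite iotaD count_cat; congr (_ + _).
  by apply: eq_in_count => b; rewrite mem_iota => b_lt; apply: (wocc_infl_low pik taum); lia.
have -> : iota (1 + k.-1) m = [seq b.-1 + k | b <- iota 1 m].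
  rewrite [in iota 1 m](iotaDl 1 0) -map_comp (_ : 1 + k.-1 = k + 0); last by lia.
  by rewrite iotaDl; apply: eq_map => v /=; lia.
rewrite count_map; apply: eq_in_count => b; rewrite mem_iota => b_lt /=.
by apply: (wocc_infl_high k0 pik taum); lia.
Qed.

(** * Adjacency conditions under inflation *)

Lemma sorted_cat3 (T : eqType) (r : rel T) x0 (x p z : seq T) : 0 < size p ->
  sorted r (x ++ p ++ z) =
    [&& sorted r x, (x == [::]) || r (last x0 x) (head x0 p), sorted r p,
        (z == [::]) || r (last x0 p) (head x0 z) & sorted r z].
Proof.
case: p => // a p _; case: x => [|b x]; case: z => [|c z];
  by rewrite /= ?cat_path /= ?cat_path /= ?cats0 ?andbT -?andbA.
Qed.

(** A letter preceding the block meets the head of [pi], a letter following it meets the last letter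
    of [pi]; [r'] encodes both conditions as adjacency to 0. *)
Lemma sorted_infl r r' k m pi tau : 0 < k -> pi \in words k -> tau \in words m.+1 ->
    (forall a b, r (a + k) (b + k) = r' a.+1 b.+1) ->
    (forall a, r (a + k) (head 0 pi) = r' a.+1 0) ->
    (forall a, r (last 0 pi) (a + k) = r' 0 a.+1) ->
  sorted r (infl pi tau) = sorted r pi && sorted r' tau.
Proof.
move=> k0 pik taum rr' rl rh; have [//|x [z [-> x0 z0]]] := words0_in taum.
have shift s : all (ltn 0) s -> exists s', s = map S s'.
  move=> s0; exists (map predn s); rewrite -map_comp -[LHS]map_id.
  by apply/eq_in_map => v /(allP s0) /= v0; rewrite prednK.
have [[x1 ->] [z1 ->]] := (shift x x0, shift z z0).
rewrite infl_cat infl_cons0 !infl_pos ?all_map; try exact/allP.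
rewrite -[0 :: map S z1]/([:: 0] ++ map S z1) !(sorted_cat3 _ 0) ?(size_words pik) //=.
have sortm s : sorted r [seq v.-1 + k | v <- map S s] = sorted r' (map S s).
  by rewrite -map_comp !sorted_map; apply: eq_sorted => a b /=; apply: rr'.
rewrite !sortm; case: (lastP x1) => [|x' a]; case: z1 => [|c z1] /=;
  rewrite ?map_rcons ?last_rcons ?rl ?rh -?size_eq0 ?size_rcons /= ?rl ?rh ?andbT //;
  by do !bool_congr.
Qed.

(** * Permutations as words *)

Section PermWords.
Variable n : nat.
Implicit Types s : 'S_n.

Definition perm_word s : seq nat := [seq val (s i) | i <- enum 'I_n].

Lemma size_perm_word s : size (perm_word s) = n.
Proof. by rewrite size_map size_enum_ord. Qed.

Lemma nth_perm_word s (i : 'I_n) : nth 0 (perm_word s) i = s i.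
Proof. by rewrite (nth_map i) ?size_enum_ord // nth_ord_enum. Qed.

Lemma perm_word_in s : perm_word s \in words n.
Proof.
rewrite mem_words; apply: uniq_perm; rewrite ?iota_uniq //.
  by rewrite map_inj_uniq ?enum_uniq // => i j /val_inj/perm_inj.
move=> v; rewrite mem_iota /=; apply/mapP/idP => [[i _ ->]|ltvn]; first exact: ltn_ord.
by exists (s^-1%g (Ordinal ltvn)); rewrite ?mem_enum ?permKV.
Qed.

Lemma perm_word_inj : injective perm_word.
Proof.
move=> s1 s2 eq_s; apply/permP => i; apply: val_inj.
by rewrite /= -!nth_perm_word eq_s.
Qed.

Lemma perm_words : perm_eq [seq perm_word s | s <- enum 'S_n] (words n).
Proof.
have u : uniq [seq perm_word s | s <- enum 'S_n].
  by rewrite map_inj_uniq ?enum_uniq //; apply: perm_word_inj.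
apply: uniq_perm; rewrite ?permutations_uniq //.
apply: (uniq_min_size u _ _).2; first by move=> _ /mapP[s _ ->]; apply: perm_word_in.
by rewrite size_permutations ?iota_uniq // size_iota size_map -cardE card_Sn.
Qed.

Lemma king_perm_word s : king s = sorted kingr (perm_word s).
Proof.
apply/idP/(sortedP 0) => [/forallP ks i|ks].
  rewrite size_perm_word => ltin; have lti := ltnW ltin.
  have := forallP (ks (Ordinal lti)) (Ordinal ltin); rewrite eqxx /=.
  by rewrite (nth_perm_word s (Ordinal lti)) (nth_perm_word s (Ordinal ltin)) /kingr; lia.
apply/forallP => i; apply/forallP => j; apply/implyP => /eqP def_j.
have := ks i; rewrite size_perm_word -def_j ltn_ord !nth_perm_word => /(_ isT).
by rewrite /kingr; lia.
Qed.

(** The boxes (0,0), (0,1), (2,0), (2,1) confine the values below [s j] to the positions from [i] to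
    [j]; the box (1,2) forbids values above [s j] between these positions. *)
Lemma is_occ12P s (i j : 'I_n) :
  reflect [/\ i < j, s i < s j & forall m : 'I_n, (s m <= s j) = (i <= m <= j)]
          (is_occ12 mesh_p s i j).
Proof.
apply: (iffP and3P) => -[ltij ltsij H]; split=> //.
  have box (x y : 'I_3) (m : 'I_n) : (x, y) \in mesh_p ->
    ~~ ((nth 0 [:: 0; i.+1; j.+1; n.+1] x < m.+1 < nth 0 [:: 0; i.+1; j.+1; n.+1] x.+1) &&
    (nth 0 [:: 0; (s i).+1; (s j).+1; n.+1] y < (s m).+1
       < nth 0 [:: 0; (s i).+1; (s j).+1; n.+1] y.+1)).
    move=> xyp; apply: contra (implyP (forallP H (x, y)) xyp) => b.
    by apply/existsP; exists m.
  move=> m.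
  have := @box (inord 0) (inord 0) m; rewrite inE /= !inordK //= => /(_ isT).
  have := @box (inord 0) (inord 1) m; rewrite inE /= !inordK //= => /(_ isT).
  have := @box (inord 1) (inord 2) m; rewrite inE /= !inordK //= => /(_ isT).
  have := @box (inord 2) (inord 0) m; rewrite inE /= !inordK //= => /(_ isT).
  have := @box (inord 2) (inord 1) m; rewrite inE /= !inordK //= => /(_ isT).
  have := ltn_ord m; have := ltn_ord (s m).
  (* The boxes speak of strict inequalities only; injectivity of [s] settles the cases where [m] is
     [i] or [j]. *)
  have eqi : (m == i :> nat) = (s m == s i :> nat) by rewrite !(inj_eq val_inj) (inj_eq perm_inj).
  have eqj : (m == j :> nat) = (s m == s j :> nat) by rewrite !(inj_eq val_inj) (inj_eq perm_inj).
  lia.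
apply/forallP => -[x y]; apply/implyP; rewrite inE /= => xyp; apply/existsPn => m.
have := H m; have := ltn_ord m; have := ltn_ord (s m).
by move: xyp; rewrite !inE /= !xpair_eqE /= => /or4P[|||/orP[]] /andP[/eqP -> /eqP ->] /=; lia.
Qed.

Lemma wocc_perm_word s (j : 'I_n) :
  reflect (exists i, is_occ12 mesh_p s i j) ((0 < s j) && wocc (perm_word s) (s j)).
Proof.
apply: (iffP andP) => [[sj0 /(woccP _ sj0)[x [y [z [def_w yb xb zb]]]]]|[i]].
  have szw := size_perm_word s; rewrite def_w !size_cat size_rcons in szw.
  have nthw m : nth 0 (perm_word s) m = if m < size x then nth 0 x m else
      if m < size x + size y then nth 0 y (m - size x) else
      if m == size x + size y then val (s j) else nth 0 z (m - (size x + size y).+1).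
    rewrite def_w nth_cat; case: ltnP => // le_xm.
    have c1 : (m - size x < size y) = (m < size x + size y) by lia.
    have c2 : (m - size x == size y) = (m == size x + size y) by lia.
    have c3 : (m - size x < (size y).+1) = (m < size x + size y) || (m == size x + size y) by lia.
    rewrite nth_cat size_rcons nth_rcons c1 c2 c3 -subnDA addnS.
    by case: (m < _); case: (m == _).
  have def_j : size x + size y = j.
    have ltjn : size x + size y < n by lia.
    suff <- : Ordinal ltjn = j by [].
    apply: (@perm_inj _ s); apply: val_inj.
    by rewrite /= -nth_perm_word nthw /= ltnNge leq_addr /= ltnn eqxx.
  have sj m : (s m <= s j) = (size x <= m <= j).
    rewrite -nth_perm_word nthw def_j; have ltmn := ltn_ord m.
    case: (ltnP m (size x)) => c1.
      by have := all_nthP 0 xb m c1; rewrite /=; lia.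
    case: (ltnP m j) => c2.
      have ltm : m - size x < size y by lia.
      by have := all_nthP 0 yb _ ltm; move=> /= ->; rewrite ltnW.
    case: eqP => [->|c3]; first by rewrite /= !leqnn.
    have ltm : m - j.+1 < size z by lia.
    by have := all_nthP 0 zb _ ltm; rewrite /=; lia.
  have n_gt0 : 0 < n by have := ltn_ord j; lia.
  (* The value 0 sits in the block, at a position other than [j] since [0 < s j]; so the block has
     at least two letters. *)
  have ltxj : size x < j.
    have := sj (s^-1%g (Ordinal n_gt0)); rewrite permKV /= => /esym m0.
    have : s^-1%g (Ordinal n_gt0) != j :> nat.
      apply: contraL sj0 => /eqP/val_inj <-.
      by rewrite permKV.
    lia.
  have ltxn := ltn_trans ltxj (ltn_ord j).
  exists (Ordinal ltxn); apply/is_occ12P; split=> //.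
  rewrite ltn_neqAle sj /= leqnn (ltnW ltxj) andbT.
  by rewrite (inj_eq val_inj) (inj_eq perm_inj) -(inj_eq val_inj) /= ltn_eqF.
case/is_occ12P => ltij ltsij sj; have sj0 : 0 < s j by lia.
split=> //; apply/woccP => //.
have szw := size_perm_word s; have ltjn := ltn_ord j.
have nthw m (ltmn : m < n) : nth 0 (perm_word s) m = s (Ordinal ltmn).
  by rewrite (nth_perm_word s (Ordinal ltmn)).
exists (take i (perm_word s)), (take (j - i) (drop i (perm_word s))), (drop j.+1 (perm_word s)).
split.
- have lt_ji : j - i < size (drop i (perm_word s)) by rewrite size_drop szw; lia.
  have := take_nth 0 lt_ji; rewrite nth_drop subnKC ?(ltnW ltij) // nth_perm_word => <-.
  have -> : j.+1 = (j - i).+1 + i by lia.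
  by rewrite -drop_drop !cat_take_drop.
- apply/(all_nthP 0) => m; rewrite size_takel ?size_drop ?szw; last by lia.
  move=> ltm; have ltmn : i + m < n by lia.
  by rewrite nth_take // nth_drop nthw sj /=; lia.
- apply/(all_nthP 0) => m; rewrite size_takel ?szw; last by lia.
  move=> ltm; have ltmn : m < n by lia.
  by rewrite nth_take // nthw /= ltnNge sj /=; lia.
- apply/(all_nthP 0) => m; rewrite size_drop szw => ltm.
  have ltmn : j.+1 + m < n by lia.
  by rewrite nth_drop nthw /= ltnNge sj /=; lia.
Qed.

Lemma occ12_perm_word s : occ12 mesh_p s = wocc12 (perm_word s).
Proof.
pose B := [set j | (0 < s j) && wocc (perm_word s) (s j)].
transitivity #|B|.
  rewrite /occ12 -(card_in_imset (f := snd)).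
    apply: eq_card => j; rewrite inE; apply/imsetP/wocc_perm_word.
      by move=> [[i j']]; rewrite inE /= => occ ->; exists i.
    by move=> [i occ]; exists (i, j); rewrite ?inE.
  (* The end [j] determines [i], the first position whose value is at most [s j]. *)
  move=> [i j] [i' j']; rewrite !inE /= => /is_occ12P[lt1 lt1' H1] /is_occ12P[lt2 lt2' H2] eqj.
  rewrite -eqj in lt2 lt2' H2 *; congr (_, _); apply: val_inj => /=.
  have := H1 i'; have := H2 i; lia.
rewrite /wocc12 size_perm_word.
(* From here occurrences are indexed by the value at their end instead of its position. *)
transitivity (count (fun b => (0 < b) && wocc (perm_word s) b) (iota 0 n)).
  have := perm_word_in s; rewrite mem_words => /seq.permP <-.
  rewrite count_map -sum1_card -sum1_count big_enum_cond.
  by apply: eq_bigl => j; rewrite inE.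
case: (n) => //= m; apply: eq_in_count => b; rewrite mem_iota => /andP[-> _] //.
Qed.

End PermWords.

(** * Contraction of the factors 21 and 12 *)

(* [w] marks the occurrences: [w = 1] counts all words, and [w = 0] counts the
   words without occurrence since [0 ^+ 0 = 1]. *)
Definition wsum (K : comNzRingType) (w : K) (r : rel nat) (n : nat) : K :=
  (\sum_(l <- words n | sorted r l) w ^+ wocc12 l)%R.

Lemma kingr_sub c d l : sorted kingr l -> sorted (kingx c d) l.
Proof. by apply: sub_sorted => a b; rewrite /kingx => ->. Qed.

Lemma sorted_kingxN c d l : sorted (kingx c d) l -> ~~ sorted kingr l ->
  exists x z, l = x ++ [:: c; d] ++ z.
Proof.
elim: l => // a [|b l] IHl //= /andP[kab kl]; rewrite negb_and.
case: (boolP (kingr a b)) kab => [_ _ /= nkl|nkab]; last first.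
  rewrite /kingx (negPf nkab) => /andP[/eqP -> /eqP ->] _.
  by exists [::], l.
have [x [z ->]] := IHl kl nkl.
by exists (a :: x), z.
Qed.

(** Contraction swaps the exceptional pair: with 10 as block, 01 inflates to the admissible 102 and
    10 to the forbidden 210; with 01 as block, 10 inflates to 201 and 01 to the forbidden 012. *)
Lemma kingx_words c d n : c + d = 1 ->
  perm_eq [seq l <- words n.+2 | sorted (kingx c d) l && ~~ sorted kingr l]
          [seq infl [:: c; d] l | l <- words n.+1 & sorted (kingx d c) l].
Proof.
move=> cd1.
have cdP : [:: c; d] \in words 2.
  by have [[-> ->]|[-> ->]] : c = 0 /\ d = 1 \/ c = 1 /\ d = 0 by lia.
have srt tau : tau \in words n.+1 ->
    sorted (kingx c d) (infl [:: c; d] tau) = sorted (kingx d c) tau.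
  move=> taun; rewrite (@sorted_infl _ (kingx d c) 2 n) //=.
  - by rewrite {1}/kingx !eqxx orbT.
  - by move=> a b; rewrite /kingx /kingr; lia.
  - by move=> a; rewrite /kingx /kingr; lia.
  - by move=> a; rewrite /kingx /kingr; lia.
apply: uniq_perm.
- by rewrite filter_uniq // permutations_uniq.
- rewrite map_inj_in_uniq ?filter_uniq ?permutations_uniq // => x y _ _ eq_xy.
  by rewrite -(@inflK 2 _ 0 x cdP isT) eq_xy inflK.
move=> l; rewrite mem_filter; apply/andP/mapP => [[/andP[kl nkl] ln]|[tau]].
  have [x [z def_l]] := sorted_kingxN kl nkl; rewrite def_l in ln kl *.
  have [_ [tau taun eq_l]] := @infl_surj _ 2 _ _ _ isT cdP ln.
  rewrite !subSS subn0 in taun.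
  by exists tau; rewrite // mem_filter taun andbT -srt // -eq_l.
rewrite mem_filter => /andP[ktau taun] ->.
rewrite srt // ktau; split; last by have := infl_words cdP taun; rewrite addn2.
apply/negP => /(@infix_sorted _ _ [:: c; d]) /=.
have [//|x [z [-> _ _]]] := words0_in taun.
rewrite infl_cat infl_cons0.
have -> : infix [:: c; d] (infl [:: c; d] x ++ [:: c; d] ++ infl [:: c; d] z).
  by apply/infixP; exists (infl [:: c; d] x), (infl [:: c; d] z).
by move=> /(_ isT); rewrite /kingr; lia.
Qed.

(** The exponent [d] is the number of occurrences in the contracted factor: one for 01, none for
    10. *)
Lemma wsum_kingx (K : comNzRingType) (w : K) c d n : c + d = 1 ->
  wsum w (kingx c d) n.+2 =
    (wsum w kingr n.+2 + w ^+ d * wsum w (kingx d c) n.+1)%R.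
Proof.
move=> cd1; rewrite /wsum (bigID (sorted kingr)) /=; congr (_ + _)%R.
  by apply: eq_bigl => l; rewrite andb_idl //; apply: kingr_sub.
rewrite -big_filter (perm_big _ (kingx_words n cd1)) big_map big_filter_cond.
rewrite mulr_sumr big_seq_cond [RHS]big_seq_cond; apply: eq_big => [l|l /andP[ln _]].
  by rewrite andbT.
rewrite -exprD; congr (_ ^+ _)%R.
have cd01 : c = 0 /\ d = 1 \/ c = 1 /\ d = 0 by lia.
rewrite (@wocc12_infl 2 n) //; first by congr (_ + _); case: cd01 => -[-> ->].
by case: cd01 => -[-> ->].
Qed.

(** * Splitting at the first occurrence *)

Definition firstocc b l :=
  [&& sorted kingr l, wocc l b & ~~ has (wocc l) (iota 1 b.-1)].

Lemma rcons_words m l : l \in words m -> rcons l m \in words m.+1.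
Proof.
rewrite !mem_words -addn1 iotaD -cats1 => lm.
by rewrite perm_cat2r.
Qed.

Lemma wocc_rcons m l c : l \in words m -> 0 < c < m -> wocc (rcons l m) c = wocc l c.
Proof.
move=> lm /andP[c0 cm]; apply/woccP/woccP => //; first last.
  move=> [x [y [z [-> yc xc zc]]]]; exists x, y, (rcons z m).
  by rewrite all_rcons zc /= cm -!cats1 -!catA.
move=> [x [y [z [def_l yc xc]]]]; case: (lastP z) def_l => [|z' v].
  by rewrite cats0 -rcons_cat => /rcons_inj[_ cm']; lia.
rewrite -!rcons_cat => /rcons_inj[-> _]; rewrite all_rcons => /andP[_ zc].
by exists x, y, z'.
Qed.

Lemma wocc_rcons_max m l : 0 < m -> l \in words m -> wocc (rcons l m) m.
Proof.
move=> m0 lm; apply/woccP => //; exists [::], l, [::]; rewrite cats0; split=> //.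
by apply/allP => v; rewrite (mem_in_words _ lm) /=; lia.
Qed.

Lemma wocc12_rcons m l : 0 < m -> l \in words m -> wocc12 (rcons l m) = (wocc12 l).+1.
Proof.
move=> m0 lm; rewrite /wocc12 size_rcons (size_words lm) /=.
have -> : iota 1 m = iota 1 m.-1 ++ [:: m].
  by rewrite -[in LHS](prednK m0) -(addn1 m.-1) iotaD /= add1n prednK.
rewrite count_cat /= wocc_rcons_max // addn0 addn1; congr _.+1.
apply: eq_in_count => c; rewrite mem_iota => cm.
by apply: wocc_rcons; lia.
Qed.

(** The new letter [m] could clash only with a final letter [m.-1]; but that letter, positive as
    [1 < m], would end an occurrence filling the whole of [l]. *)
Lemma king_rcons m l : 1 < m -> l \in words m -> sorted kingr l -> wocc12 l = 0 ->
  sorted kingr (rcons l m).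
Proof.
move=> m1 lm kl /eqP; rewrite /wocc12 (size_words lm) eqn0Ngt -has_count => /hasPn no.
case: (lastP l) lm kl no => [/size_words /= m0|l' v lm kl no]; first by lia.
have uv := uniq_words lm; rewrite rcons_uniq in uv.
have szl := size_words lm; rewrite size_rcons in szl.
have ltv x : x \in rcons l' v -> x < m by rewrite (mem_in_words _ lm).
have v_m : v.+1 < m.
  have vm : v < m by apply: ltv; rewrite mem_rcons mem_head.
  rewrite ltn_neqAle vm andbT; apply/eqP => v1m.
  have : wocc (rcons l' v) v.
    apply/woccP; first by lia.
    exists [::], l', [::]; rewrite cats0; split=> //.
    by apply/allP => x xl /=; have := ltv x; rewrite mem_rcons inE xl orbT => /(_ isT); lia.
  by apply/negP/no; rewrite mem_iota; lia.
case: l' kl {uv szl ltv lm no} => [|a l'] /=; first by rewrite /kingr v_m.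
by rewrite !rcons_path last_rcons => ->; rewrite /kingr v_m.
Qed.

Lemma king_rcons_inv l m : sorted kingr (rcons l m) -> sorted kingr l.
Proof. by case: l => //= a l; rewrite rcons_path => /andP[]. Qed.

Section FirstOccurrence.
Variables (n b : nat).
Hypotheses (b_gt1 : 1 < b) (b_ltn : b < n).

Let pw := [seq l <- words b | sorted kingr l && (wocc12 l == 0)].

(** The block ends with its maximum [b], so [b.+1] cannot follow it; it starts below [b], so [b.+1]
    may precede it. In [tau] the latter is the exceptional factor 10. *)
Lemma firstocc_infl rho tau : rho \in words b -> tau \in words (n - b) ->
  firstocc b (infl (rcons rho b) tau) =
    [&& sorted kingr rho, wocc12 rho == 0 & sorted (kingx 1 0) tau].
Proof.
move=> rhob; have def_n : n - b = (n - b).-1.+1 by lia.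
rewrite def_n => taun; have pib := rcons_words rhob.
rewrite /firstocc (wocc_infl_low pib taun); last by lia.
rewrite wocc_rcons_max //=; last by lia.
have -> : has (wocc (infl (rcons rho b) tau)) (iota 1 b.-1) = (wocc12 rho != 0).
  rewrite /wocc12 (size_words rhob) -lt0n -has_count; apply: eq_in_has => c.
  rewrite mem_iota => c_lt; rewrite (wocc_infl_low pib taun) ?wocc_rcons //; lia.
rewrite negbK (@sorted_infl _ (kingx 1 0) b.+1 _ _ _ _ pib taun) //; first last.
- by move=> a; rewrite last_rcons /kingx /kingr; lia.
- move=> a; have : head 0 (rcons rho b) < b.
    case: (rho) rhob => [/size_words /= b0|v r /mem_in_words rhob /=]; first by lia.
    by rewrite -rhob mem_head.
  by rewrite /kingx /kingr; lia.
- by move=> a c; rewrite /kingx /kingr; lia.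
case: eqP => [rho0|_]; last by rewrite !andbF.
rewrite andbT; congr (_ && _); apply/idP/idP => [|krho]; first exact: king_rcons_inv.
exact: king_rcons.
Qed.

Lemma firstocc_words :
  perm_eq [seq l <- words n | firstocc b l]
          [seq infl (rcons rho b) tau | rho <- pw,
             tau <- [seq l <- words (n - b) | sorted (kingx 1 0) l]].
Proof.
have def_n : n - b = (n - b).-1.+1 by lia.
apply: uniq_perm.
- by rewrite filter_uniq // permutations_uniq.
- apply: allpairs_uniq; rewrite ?filter_uniq ?permutations_uniq //.
  move=> [rho tau] [rho' tau'] /allpairsP[[rho1 tau1] /= [+ + [-> ->]]].
  move=> + + /allpairsP[[rho2 tau2] /= [+ + [-> ->]]].
  rewrite !mem_filter => /andP[_ rhob] /andP[_ taun] /andP[_ rhob'] /andP[_ taun'].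
  rewrite def_n in taun taun'; move=> eq_i.
  have [pib pib'] := (rcons_words rhob, rcons_words rhob').
  have eq_pi := filter_infl pib taun; rewrite eq_i (filter_infl pib' taun') in eq_pi.
  have [->] := rcons_inj eq_pi; congr (_, _).
  by move: eq_i => /= eq_i; rewrite -(inflK tau1 pib (ltn0Sn b)) eq_i inflK.
move=> l; rewrite mem_filter; apply/andP/allpairsP => [[fl ln]|[[rho tau] /= []]]; last first.
  rewrite !mem_filter => /andP[/andP[krho rho0] rhob] /andP[ktau taun] ->.
  rewrite firstocc_infl // krho rho0 ktau; split=> //.
  move: taun; rewrite def_n => /(infl_words (rcons_words rhob)).
  by rewrite (_ : _ + b.+1 = n) //; lia.
have b0 : 0 < b by lia.
have /and3P[_ /(woccP _ b0)[x [y [z [def_l yb xb zb]]]] _] := fl.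
(* The block consists of all letters of [l] that are at most [b], hence is itself a word. *)
have pib : rcons y b \in words b.+1.
  have -> : rcons y b = filter (leq^~ b) l.
    rewrite def_l !filter_cat (filter_leq_gt xb) (filter_leq_gt zb) cats0 /=.
    by rewrite filter_rcons leqnn (all_filterP yb).
  rewrite mem_words; apply: uniq_perm; rewrite ?iota_uniq ?filter_uniq ?(uniq_words ln) //.
  move=> v; rewrite mem_filter (mem_in_words _ ln) mem_iota; lia.
have rhob : y \in words b.
  by move: pib; rewrite !mem_words -addn1 iotaD -cats1 perm_cat2r.
rewrite def_l in ln.
have [_ [tau taun eq_l]] := @infl_surj n b.+1 _ x z isT pib ln.
rewrite (_ : (n - b.+1).+1 = n - b) in taun; last by lia.
move: fl; rewrite def_l eq_l firstocc_infl // => /and3P[ky y0 ktau].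
by exists (y, tau); rewrite /= !mem_filter ky y0 rhob ktau taun.
Qed.

Lemma wsum_firstocc (K : comNzRingType) (w : K) :
  (\sum_(l <- words n | firstocc b l) w ^+ wocc12 l =
     w * wsum 0 kingr b * wsum w (kingx 1 0) (n - b))%R.
Proof.
have def_n : n - b = (n - b).-1.+1 by lia.
rewrite -big_filter (perm_big _ firstocc_words) big_allpairs_dep /=.
rewrite /wsum -mulrA big_distrl mulr_sumr /= big_filter.
rewrite [LHS]big_mkcondr [RHS]big_seq_cond [LHS]big_seq_cond.
(* The power [0 ^+ wocc12 rho] selects the [rho] without occurrence; its block then has exactly one,
   the source of the factor [w]. *)
apply: eq_bigr => rho /andP[rhob _]; rewrite expr0n; case: eqP => [rho0|_].
  rewrite mul1r mulr_sumr big_filter big_seq_cond [RHS]big_seq_cond.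
  apply: eq_bigr => tau /andP[taun _]; rewrite -exprS; congr (_ ^+ _)%R.
  rewrite def_n in taun; rewrite (wocc12_infl _ (rcons_words rhob) taun) //.
  by rewrite wocc12_rcons ?rho0 //; lia.
by rewrite mul0r mulr0.
Qed.

End FirstOccurrence.

(** The letters 0 and 1 would be adjacent, against the king condition. This accounts for the [- t]
    in the factor P - 1 - t. *)
Lemma firstocc1 n l : 0 < n -> l \in words n -> ~~ firstocc 1 l.
Proof.
move=> n0 ln; apply/negP => /and3P[kl /(woccP _ (ltnSn 0))[x [y [z [def_l y1 x1 z1]]]] _].
have : infix (rcons y 1) l by apply/infixP; exists x, z.
move/infix_sorted => /(_ _ kl); case: (lastP y) y1 def_l => [_ def_l _|y' v].
  have : 0 \in l by rewrite (mem_in_words _ ln).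
  rewrite def_l mem_cat /= inE /= => /orP[] /(allP _ _) => /(_ (ltn 1)).
    by move/(_ x1).
  by move/(_ z1).
rewrite all_rcons => /andP[v1 _] _; rewrite -!cats1 -catA => /(@infix_sorted _ _ [:: v; 1]).
have -> : infix [:: v; 1] (y' ++ [:: v] ++ [:: 1]).
  by apply/infixP; exists y', [::]; rewrite cats0.
by move=> /(_ isT) /=; move: v1; rewrite /kingr /=; lia.
Qed.

Local Open Scope ring_scope.

(** * Functional equations for the power series *)

Section Series.
Variable K : comNzRingType.
Implicit Types (w c : K) (f g : fps K) (n : nat).

Lemma fpsCM c f n : (fpsC c * f) n = c * f n.
Proof.
by rewrite fpsME big_ord_recl /= subn0 big1 ?addr0 // => i _; rewrite mul0r.
Qed.

Lemma fpsXM f n : (fpsX * f) n = if n is m.+1 then f m else 0.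
Proof.
rewrite fpsME; case: n => [|n]; first by rewrite big_ord1 mul0r.
rewrite !big_ord_recl /= mul0r add0r mul1r subSS subn0 big1 ?addr0 // => i _.
by rewrite mul0r.
Qed.

Lemma wsum0 w r : wsum w r 0 = 1.
Proof. by rewrite /wsum unlock /= addr0. Qed.

Lemma wsum1 w r : wsum w r 1 = 1.
Proof. by rewrite /wsum unlock /= addr0. Qed.

Lemma wsum_firstocc_split w n :
  wsum w kingr n.+1 = wsum 0 kingr n.+1 +
    \sum_(b < n) \sum_(l <- words n.+1 | firstocc b.+1 l) w ^+ wocc12 l.
Proof.
(* [N m] keeps the king words with no occurrence ending at a letter from 1 to [m]; its successive
   differences are the first-occurrence sums, so the sum telescopes. *)
pose N m := \sum_(l <- words n.+1 | sorted kingr l && ~~ has (wocc l) (iota 1 m))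
  w ^+ wocc12 l.
have NS m : N m = N m.+1 + \sum_(l <- words n.+1 | firstocc m.+1 l) w ^+ wocc12 l.
  rewrite /N (bigID (wocc^~ m.+1)) addrC; congr (_ + _); apply: eq_bigl => l.
    by rewrite /firstocc -andbA; congr (_ && _); rewrite andbC.
  by rewrite -(addn1 m) iotaD has_cat /= orbF negb_or andbA add1n addn1.
have -> : wsum w kingr n.+1 = N 0%N by apply: eq_bigl => l; rewrite andbT.
have -> : wsum 0 kingr n.+1 = N n.
  rewrite /wsum /N [RHS]big_mkcondr [LHS]big_seq_cond [RHS]big_seq_cond.
  apply: eq_bigr => l /andP[ln _]; rewrite expr0n.
  have <- : (wocc12 l == 0)%N = ~~ has (wocc l) (iota 1 n).
    by rewrite /wocc12 (size_words ln) eqn0Ngt -has_count.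
  by case: eqP => // ->.
suff Nk k : N 0%N = N k +
    \sum_(b < k) \sum_(l <- words n.+1 | firstocc b.+1 l) w ^+ wocc12 l by exact: Nk.
elim: k => [|k IHk]; first by rewrite big_ord0 addr0.
by rewrite IHk // big_ord_recr /= NS -addrA; congr (_ + _); rewrite addrC.
Qed.

Section Equations.
Variable w : K.
Let t : fps K := fpsX.
Let W : fps K := fpsC w.
Let E : fps K := Fps (wsum w kingr).
Let P : fps K := Fps (wsum 0 kingr).
Let F : fps K := Fps (wsum w (kingx 1 0)).
Let G : fps K := Fps (wsum w (kingx 0 1)).

Lemma kingx10_eq : F = E + t * (G - 1).
Proof.
apply: fpsP => n; rewrite fpsDE fpsXM; case: n => [|[|n]] /=.
- by rewrite !wsum0 addr0.
- by rewrite !wsum1 wsum0 subrr addr0.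
- by rewrite wsum_kingx // expr0 mul1r oppr0 addr0.
Qed.

Lemma kingx01_eq : G = E + W * (t * (F - 1)).
Proof.
apply: fpsP => n; rewrite fpsDE fpsCM fpsXM; case: n => [|[|n]] /=.
- by rewrite !wsum0 mulr0 addr0.
- by rewrite !wsum1 wsum0 subrr mulr0 addr0.
- by rewrite wsum_kingx // expr1 oppr0 addr0.
Qed.

Lemma firstocc_eq : E = P + W * ((P - 1 - t) * (F - 1)).
Proof.
apply: fpsP => -[|n]; rewrite fpsDE fpsCM fpsME.
  by rewrite big_ord1 /= !wsum0 subrr oppr0 addr0 mul0r mulr0 addr0.
(* Both end terms of the convolution vanish, as P - 1 - t and F - 1 have no constant term. *)
rewrite big_ord_recl big_ord_recr /= wsum_firstocc_split; congr (_ + _).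
rewrite wsum0 subrr oppr0 !add0r mul0r add0r /bump /= add1n subnn wsum0 subrr mulr0 addr0.
(* For the letter 1 both sides are 0: the coefficient of t in P - 1 - t on the right, [firstocc1] on
   the left. *)
rewrite mulr_sumr; apply: eq_bigr => -[[|b] /= ltbn] _; rewrite /bump /= !add1n.
  rewrite wsum1 addr0 subrr mul0r mulr0 big_seq_cond big1 // => l /andP[ln].
  by rewrite (negPf (firstocc1 _ ln)).
rewrite wsum_firstocc //.
rewrite oppr0 !addr0 mulrA subn_eq0 leqNgt ltnS ltbn /= oppr0 addr0 //.
Qed.

Lemma king_wocc_eq : (1 - W * t ^+ 2) * (E - P) = W * (P - 1 - t) * (1 + t) * (E - 1).
Proof.
(* This eliminates [G] between the equations for [F] and [G]. *)
have FE : (1 - W * t ^+ 2) * (F - 1) = (1 + t) * (E - 1).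
  have := kingx10_eq; rewrite kingx01_eq => FE.
  have -> : (1 - W * t ^+ 2) * (F - 1) = F - (1 + W * t ^+ 2 * (F - 1)) by ring.
  by rewrite {1}FE; ring.
rewrite {1}firstocc_eq.
have -> : (1 - W * t ^+ 2) * (P + W * ((P - 1 - t) * (F - 1)) - P) =
  W * (P - 1 - t) * ((1 - W * t ^+ 2) * (F - 1)) by ring.
by rewrite FE; ring.
Qed.

End Equations.
End Series.

(** * Identification with the series of the theorem *)

Lemma sum_king_perms (K : comNzRingType) (w : K) n :
  \sum_(s in king_perms n) w ^+ occ12 mesh_p s = wsum w kingr n.
Proof.
rewrite /wsum -(perm_big _ (perm_words n)) big_map big_enum_cond /=.
by apply: eq_big => [s|s _]; rewrite ?inE -?king_perm_word ?occ12_perm_word.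
Qed.

Lemma king_gfE (K : comNzRingType) : king_gf K = Fps (wsum 1 kingr).
Proof.
apply: fpsP => n /=; rewrite -sum_king_perms -sum1_card natr_sum.
by apply: eq_bigr => s _; rewrite expr1n.
Qed.

Lemma avoid_gfE : avoid_gf mesh_p = Fps (wsum 0 kingr).
Proof.
apply: fpsP => n /=; rewrite -sum_king_perms -sum1_card natr_sum.
under [LHS]eq_bigl do rewrite inE.
by rewrite big_mkcondr; apply: eq_bigr => s _; rewrite expr0n; case: eqP.
Qed.

Lemma distr_gfE : distr_gf mesh_p = Fps (wsum 'X kingr).
Proof. by apply: fpsP => n /=; rewrite sum_king_perms. Qed.

Lemma card_king_perms n : #|king_perms n| = count (sorted kingr) (words n).
Proof.
rewrite -(seq.permP (perm_words n)) count_map -sum1_card -sum1_count big_enum_cond.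
by apply: eq_bigl => s; rewrite inE king_perm_word.
Qed.

(** * Closed forms *)

Section Solution.
Variable K : comUnitRingType.
Let A : fps K := king_gf K.
Let t : fps K := fpsX.
Let P : fps K := Fps (wsum 0 kingr).

Lemma king_gf_subX_unit : A - t \is a GRing.unit.
Proof. by rewrite fps_unitE fpsDE fpsNE king_gf0 /= subr0 unitr1. Qed.

Lemma avoid_mul_eq : P * (A - t) = 2 * A - t - 1.
Proof.
have := king_wocc_eq (1 : K); rewrite -/t -/P -king_gfE -/A => PA.
(* At weight 1 both sides of [PA] contain the factor [1 + t]; cancelling it leaves an equation
   linear in [P]. *)
have U : 1 + t \is a GRing.unit by rewrite fps_unitE fpsDE /= addr0 unitr1.
apply: (mulrI U); apply/eqP; rewrite -subr_eq0; apply/eqP.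
rewrite (_ : fpsC 1 = 1) // in PA.
have -> : (1 + t) * (P * (A - t)) - (1 + t) * (2 * A - t - 1) =
  1 * (P - 1 - t) * (1 + t) * (A - 1) - (1 - 1 * t ^+ 2) * (A - P) by ring.
by rewrite PA subrr.
Qed.

Variable w : K.
Let u : fps K := fpsC w.
Let E : fps K := Fps (wsum w kingr).

Definition distr_den : fps K := - u + t * (1 - u + u * t) - (1 - u) * A.
Definition distr_num : fps K := (1 + t) * (1 - u) + (- 2 + u + u * t ^+ 2) * A.

Lemma distr_mul_eq : E * distr_den = distr_num.
Proof.
apply/esym/eqP; rewrite -subr_eq0; apply/eqP; rewrite /distr_num /distr_den.
have Ew := king_wocc_eq w; rewrite -/t -/P -/u -/E in Ew.
(* The multiplier of the last bracket is minus the coefficient of [P] in the equation multiplied by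
   [A - t], so [P] cancels. *)
have -> : (1 + t) * (1 - u) + (- 2 + u + u * t ^+ 2) * A
    - E * (- u + t * (1 - u + u * t) - (1 - u) * A) =
  (A - t) * ((1 - u * t ^+ 2) * (E - P) - u * (P - 1 - t) * (1 + t) * (E - 1))
  + (1 - u * t ^+ 2 + u * (1 + t) * (E - 1)) * (P * (A - t) - (2 * A - t - 1)) by ring.
by rewrite Ew avoid_mul_eq !subrr !mulr0 addr0.
Qed.

(** The constant coefficient is -w - (1 - w) = -1. *)
Lemma distr_den_unit : distr_den \is a GRing.unit.
Proof.
rewrite fps_unitE !fpsDE !fpsNE /u fpsXM mulrBl mul1r !fpsDE fpsNE fpsCM king_gf0 /=.
rewrite (_ : _ + _ = - 1) ?unitrN1 //; ring.
Qed.
End Solution.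

(** * Initial coefficients *)

(* The last entry is factored because [ring] does not read nat literals above 5000. *)
Lemma king_perms_small : [seq #|king_perms n| | n <- iota 0 9]
  = [:: 1; 1; 0; 0; 2; 14; 90; 646; 2 * 2621]%N.
Proof. by under eq_map do rewrite card_king_perms. Qed.

(** Since the denominator has constant coefficient -1, comparing coefficients in [distr_mul_eq] can
    be solved for [E n]. *)
Lemma distr_coef_rec (K : comUnitRingType) (w : K) n (E := Fps (wsum w kingr)) :
  E n = \sum_(i < n) E i * distr_den w (n - i)%N - distr_num w n.
Proof.
have := congr1 (fun f : fps K => f n) (distr_mul_eq w).
rewrite fpsME big_ord_recr subnn => <-; rewrite -/E.
have -> : distr_den w 0%N = -1.
  rewrite /distr_den mulrBl mul1r !fpsDE !fpsNE fpsXM fpsDE fpsNE fpsCM king_gf0 /=.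
  ring.
by rewrite opprD addrA subrr sub0r mulrN1 opprK.
Qed.

Local Ltac unfold_rec rec :=
  rewrite rec !big_ord_recr big_ord0 ![nat_of_ord _]/= ?subSS ?subn0.

Lemma distr_coef_small (K : comUnitRingType) (w : K) :
  [seq wsum w kingr n | n <- iota 0 9]
     = [:: 1; 1; 0; 0; 2; 12 + 2 * w; 76 + 14 * w;
               556 + 88 * w + 2 * w ^+ 2; 4592 + 636 * w + 14 * w ^+ 2].
Proof.
have := king_perms_small => /=.
case=> a0 a1 a2 a3 a4 a5 a6 a7 a8.
(* Denominator and numerator are expanded into products by constants and by t, whose coefficients
   need no convolution. *)
have denE n : distr_den w n = - (if n == 0%N then w else 0) + (if n == 1%N then 1 - w else 0)
    + (if n == 2%N then w else 0) - #|king_perms n|%:R + w * #|king_perms n|%:R.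
  have -> : distr_den w = - fpsC w + fpsX * (1 - fpsC w + fpsX * fpsC w)
    - king_gf K + fpsC w * king_gf K.
    by rewrite /distr_den; ring.
  rewrite !fpsDE !fpsNE fpsCM fpsXM; case: n => [|[|[|n]]]; rewrite ?fpsDE ?fpsNE ?fpsXM /=; ring.
have numE n : distr_num w n = (if n == 0%N then 1 - w else 0) + (if n == 1%N then 1 - w else 0)
    - #|king_perms n|%:R *+ 2 + w * #|king_perms n|%:R
    + w * (if n is m.+2 then #|king_perms m|%:R else 0).
  have -> : distr_num w = 1 - fpsC w + fpsX * (1 - fpsC w) - king_gf K - king_gf K
    + fpsC w * king_gf K + fpsC w * (fpsX * (fpsX * king_gf K)).
    by rewrite /distr_num; ring.
  rewrite !fpsDE !fpsNE !fpsCM !fpsXM; case: n => [|[|n]]; rewrite ?fpsXM /=; ring.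
(* From degree 3 on, only [(w - 1) * #|king_perms n|%:R] remains. *)
have d1 : distr_den w 1%N = 0 by rewrite denE a1 /=; ring.
have d2 : distr_den w 2%N = w by rewrite denE a2 /=; ring.
have d3 : distr_den w 3%N = 0 by rewrite denE a3 /=; ring.
have d4 : distr_den w 4%N = 2 * (w - 1) by rewrite denE a4 /=; ring.
have d5 : distr_den w 5%N = 14 * (w - 1) by rewrite denE a5 /=; ring.
have d6 : distr_den w 6%N = 90 * (w - 1) by rewrite denE a6 /=; ring.
have d7 : distr_den w 7%N = 646 * (w - 1) by rewrite denE a7 /=; ring.
have d8 : distr_den w 8%N = 2 * 2621 * (w - 1) by rewrite denE a8 natrM /=; ring.
pose e n := wsum w kingr n.
have rec n : e n = \sum_(i < n) e i * distr_den w (n - i)%N - distr_num w n.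
  exact: distr_coef_rec.
have e0 : e 0%N = 1 by rewrite rec numE a0 big_ord0 /=; ring.
have e1 : e 1%N = 1.
  unfold_rec rec.
  rewrite numE a1 d1 e0 /=; ring.
have e2 : e 2%N = 0.
  unfold_rec rec.
  rewrite numE a2 d1 d2 e0 e1 a0 /=; ring.
have e3 : e 3%N = 0.
  unfold_rec rec.
  rewrite numE a3 d1 d2 d3 e0 e1 e2 a1 /=; ring.
have e4 : e 4%N = 2.
  unfold_rec rec.
  rewrite numE a4 d1 d2 d3 d4 e0 e1 e2 e3 a2 /=; ring.
have e5 : e 5%N = 12 + 2 * w.
  unfold_rec rec.
  rewrite numE a5 d1 d2 d3 d4 d5 e0 e1 e2 e3 e4 a3 /=; ring.
have e6 : e 6%N = 76 + 14 * w.
  unfold_rec rec.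
  rewrite numE a6 d1 d2 d3 d4 d5 d6 e0 e1 e2 e3 e4 e5 a4 /=; ring.
have e7 : e 7%N = 556 + 88 * w + 2 * w ^+ 2.
  unfold_rec rec.
  rewrite numE a7 d1 d2 d3 d4 d5 d6 d7 e0 e1 e2 e3 e4 e5 e6 a5 /=; ring.
have e8 : e 8%N = 4592 + 636 * w + 14 * w ^+ 2.
  unfold_rec rec.
  rewrite numE a8 d1 d2 d3 d4 d5 d6 d7 d8 e0 e1 e2 e3 e4 e5 e6 e7 a6 natrM /=; ring.
by rewrite /= -!/(e _) e0 e1 e2 e3 e4 e5 e6 e7 e8.
Qed.

Theorem theorem4p7 :
  [/\ (let A : fps int := king_gf int in
       let t : fps int := fpsX in
       avoid_gf mesh_p = (2 * A - t - 1) / (A - t)),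
      (let A : fps {poly int} := king_gf {poly int} in
       let t : fps {poly int} := fpsX in
       let u : fps {poly int} := fpsC 'X in
       distr_gf mesh_p
         = ((1 + t) * (1 - u) + (- 2 + u + u * t ^+ 2) * A)
           / (- u + t * (1 - u + u * t) - (1 - u) * A))
    & (let u : {poly int} := 'X in
       [seq distr_gf mesh_p n | n <- iota 0 9]
         = [:: 1; 1; 0; 0; 2; 12 + 2 * u; 76 + 14 * u;
               556 + 88 * u + 2 * u ^+ 2; 4592 + 636 * u + 14 * u ^+ 2])].
Proof.
split=> [A t|A t u|u].
- apply: (mulIr (king_gf_subX_unit int)).
  by rewrite mulrVK ?king_gf_subX_unit // avoid_gfE avoid_mul_eq.
- apply: (mulIr (distr_den_unit 'X)).
  by rewrite [RHS]mulrVK ?distr_den_unit // distr_gfE distr_mul_eq.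
- by rewrite distr_gfE; apply: distr_coef_small.
Qed.
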